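(* Let $G$ be a faithful weakly hyperbolic group. If $G$ is not lim-free, then $G$ is monolithic and its monolith is an infinite simple group.
   Context: A hyperbolic space is a geodesic metric space $S$ (not assumed proper) such that for some $\delta\ge 0$, $\langle x|y\rangle_o\ge\min\{\langle x|z\rangle_o,\langle z|y\rangle_o\}-\delta$ for all $x,y,z,o\in S$, where $\langle x|y\rangle_o=\frac12(d(x,o)+d(y,o)-d(x,y))$. Its Gromov boundary $\partial S$ is the set of equivalence classes of sequences $(x_i)$ in $S$ with $\langle x_i|x_j\rangle_o\to\infty$ as $i,j\to\infty$, where $(x_i)\sim(y_i)$ iff $\langle x_i|y_j\rangle_o\to\infty$; a sequence in the class $a$ is said to converge to $a$. For $a,b\in\partial S$, $\langle a|b\rangle_o$ is the infimum of $\liminf_{i,j}\langle x_i|y_j\rangle_o$ over sequences $x_i\to a$, $y_j\to b$; $\partial S$ is topologized so that the sets $\{b\in\partial S:\langle a|b\rangle_o>r\}$, $r\ge 0$, form a neighborhood base at $a$. All group actions on hyperbolic spaces are by isometries; they extend to actions by homeomorphisms on $\partial S$. The limit set $\Lambda_S(G)\subseteq\partial S$ of a group $G$ acting on $S$ is the set of points of $\partial S$ that are limits of sequences in an orbit $Gs$ (independent of $s\in S$), with the subspace topology. An element $g\in G$ is loxodromic if $\langle g\rangle$ has unbounded orbits in $S$ and fixes exactly two points of $\partial S$. The action of $G$ on $S$ is of general type if its orbits are unbounded and $G$ contains two loxodromic elements with disjoint fixed point sets in $\partial S$. An action by homeomorphisms on a topological space $X$ is topologically free if for every nontrivial element $g$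 the set of fixed points of $g$ in $X$ has empty interior. A group is faithful weakly hyperbolic if it admits a general type action on a hyperbolic space such that the induced action on the limit set is faithful. It is lim-free if it admits a general type action on a hyperbolic space such that the induced action on the limit set is topologically free. The monolith of a group $G$ is the intersection of all non-trivial normal subgroups of $G$; $G$ is monolithic if its monolith is non-trivial. *)

(* Defs.v *)
From HB Require Import structures.
From mathcomp Require Import all_boot all_order all_algebra.
From mathcomp Require Import all_classical all_reals all_analysis.
From mathcomp Require Import lra.

Set Implicit Arguments.
Unset Strict Implicit.
Unset Printing Implicit Defensive.

Import Order.TTheory GRing.Theory Num.Theory.
Import numFieldNormedType.Exports.

Local Open Scope classical_set_scope.
Local Open Scope ring_scope.

Section MetricSpaces.
Context {R : realType} {S : metricType R}.
Implicit Types (x y z o : S) (A : set S).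

Definition gromov_product o x y : R :=
  (mdist x o + mdist y o - mdist x y) / 2.

Definition geodesic_space : Prop :=
  forall x y, exists c : R -> S,
    [/\ c 0 = x, c (mdist x y) = y &
        forall s t, 0 <= s <= mdist x y -> 0 <= t <= mdist x y ->
          mdist (c s) (c t) = `|s - t|].

Definition gromov_hyperbolic : Prop :=
  exists2 delta : R, 0 <= delta &
    forall x y z o, gromov_product o x y >=
      Num.min (gromov_product o x z) (gromov_product o z y) - delta.

Definition metric_bounded A : Prop :=
  exists C : R, forall x y, A x -> A y -> mdist x y <= C.

End MetricSpaces.
Arguments geodesic_space {R} S.
Arguments gromov_hyperbolic {R} S.

HB.mixin Record Metric_isHyperbolic (R : realType) S & Metric R S := {
  hyperbolic_geodesic : geodesic_space S;
  hyperbolic_gromov : gromov_hyperbolic S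
}.

#[short(type="hyperbolicType")]
HB.structure Definition Hyperbolic (R : realType) :=
  {S of Metric R S & Metric_isHyperbolic R S}.

Section Boundary.
Context {R : realType} {S : hyperbolicType R}.
Implicit Types (o : S) (x y : nat -> S).

Definition gromov_seq_product o x y (ij : nat * nat) : R :=
  gromov_product o (x ij.1) (y ij.2).

(* These two conditions do not depend on the base point, and asking them at
   every base point avoids choosing one (see gromov_sim_base). *)
Definition gromov_sim x y : Prop :=
  forall o, gromov_seq_product o x y @ filter_prod \oo \oo --> +oo.

Definition gromov_sequence x : Prop := gromov_sim x x.

Definition gromov_class x : set (nat -> S) :=
  [set y | gromov_sequence y /\ gromov_sim x y].

End Boundary.

(* A boundary point is an equivalence class, i.e. literally the set of the
   sequences that converge to it. *)
Record boundary (R : realType) (S : hyperbolicType R) := Boundary {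
  boundary_class : set (nat -> S);
  boundary_classP :
    exists2 x, gromov_sequence x & boundary_class = gromov_class x
}.

HB.instance Definition _ (R : realType) (S : hyperbolicType R) :=
  gen_eqMixin (boundary S).
HB.instance Definition _ (R : realType) (S : hyperbolicType R) :=
  gen_choiceMixin (boundary S).

Definition converges_to (R : realType) (S : hyperbolicType R)
  (x : nat -> S) (a : boundary S) : Prop := boundary_class a x.

Definition boundary_product (R : realType) (S : hyperbolicType R)
    (o : S) (a b : boundary S) : \bar R :=
  ereal_inf [set l | exists x y, [/\ converges_to x a, converges_to y b &
    l = limf_einf (fun ij => (gromov_seq_product o x y ij)%:E)
                  (filter_prod \oo \oo)]].

(* As above, quantifying over the base point is harmless: boundary_nbhs_base *)
Definition boundary_nbhs (R : realType) (S : hyperbolicType R)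
    (a : boundary S) : set_system (boundary S) :=
  [set A | forall o, exists2 r : R, 0 <= r &
    [set b | (r%:E < boundary_product o a b)%E] `<=` A].

HB.instance Definition _ (R : realType) (S : hyperbolicType R) :=
  hasNbhs.Build (boundary S) (@boundary_nbhs R S).

Section BoundaryTheory.
Context {R : realType} {S : hyperbolicType R}.
Implicit Types (o u v w : S) (x y z : nat -> S) (a b c : boundary S).

Lemma gromov_productC o u v : gromov_product o u v = gromov_product o v u.
Proof.
by rewrite /gromov_product (metric_sym u v) (addrC (mdist u o)).
Qed.

Lemma gromov_product_base o o' u v :
  gromov_product o u v <= gromov_product o' u v + mdist o o'.
Proof.
rewrite /gromov_product.
have := metric_triangle u o' o; have := metric_triangle v o' o.
rewrite (metric_sym o' o); lra.
Qed.

Lemma near_prodP (P : nat * nat -> Prop) :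
  filter_prod \oo \oo P <->
  exists N, forall i j, (N <= i)%N -> (N <= j)%N -> P (i, j).
Proof.
split=> [[[A B]] /= [[N1 _ AN1] [N2 _ BN2]] AB|[N HN]].
- exists (maxn N1 N2) => i j; rewrite !geq_max => /andP[iN1 _] /andP[_ jN2].
  by apply: AB; split; [exact: AN1|exact: BN2].
- exists ([set i | (N <= i)%N], [set j | (N <= j)%N]) => /=.
    by split; exists N.
  by move=> [i j] /= [? ?]; exact: HN.
Qed.

Lemma gromov_pinftyP o x y :
  gromov_seq_product o x y @ filter_prod \oo \oo --> +oo <->
  forall M, exists N, forall i j, (N <= i)%N -> (N <= j)%N ->
    M <= gromov_product o (x i) (y j).
Proof.
rewrite cvgryPge; split=> h M; have := h M; first by move/near_prodP.
by move=> hM; apply/near_prodP.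
Qed.

Lemma gromov_sim_base o x y :
  gromov_seq_product o x y @ filter_prod \oo \oo --> +oo -> gromov_sim x y.
Proof.
move=> /gromov_pinftyP h o'; apply/gromov_pinftyP => M.
have [N HN] := h (M + mdist o o'); exists N => i j iN jN.
have := HN i j iN jN; have := gromov_product_base o o' (x i) (y j); lra.
Qed.

Lemma gromov_sim_sym x y : gromov_sim x y -> gromov_sim y x.
Proof.
move=> h o; apply/gromov_pinftyP => M.
have /gromov_pinftyP/(_ M)[N HN] := h o.
by exists N => i j iN jN; rewrite gromov_productC; exact: HN.
Qed.

Lemma gromov_sim_trans y x z :
  gromov_sim x y -> gromov_sim y z -> gromov_sim x z.
Proof.
move=> xy yz o; apply/gromov_pinftyP => M.
have [d d0 hyp] := @hyperbolic_gromov R S.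
have /gromov_pinftyP/(_ (M + d))[N1 HN1] := xy o.
have /gromov_pinftyP/(_ (M + d))[N2 HN2] := yz o.
exists (maxn N1 N2) => i j; rewrite !geq_max => /andP[i1 i2] /andP[j1 j2].
pose k := maxn N1 N2.
have h1 := HN1 i k i1 (leq_maxl _ _).
have h2 := HN2 k j (leq_maxr _ _) j2.
apply: le_trans (hyp (x i) (z j) (y k) o).
by rewrite lerBrDr le_min h1.
Qed.

Lemma converges_to_seq x a : converges_to x a -> gromov_sequence x.
Proof.
by rewrite /converges_to; case: (boundary_classP a) => y _ -> [].
Qed.

Lemma converges_to_sim x y a :
  converges_to x a -> converges_to y a -> gromov_sim x y.
Proof.
rewrite /converges_to; case: (boundary_classP a) => z _ -> [_ zx] [_ zy].
exact: gromov_sim_trans (gromov_sim_sym zx) zy.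
Qed.

Lemma converges_to_ex a : exists x, converges_to x a.
Proof.
rewrite /converges_to; case: (boundary_classP a) => x xx ->.
by exists x.
Qed.

Lemma boundary_productP o a b (r : R) :
  (r%:E < boundary_product o a b)%E ->
  forall x y, converges_to x a -> converges_to y b ->
    exists N, forall i j, (N <= i)%N -> (N <= j)%N ->
      r <= gromov_product o (x i) (y j).
Proof.
move=> rab x y xa yb.
have : (r%:E < limf_einf (fun ij => (gromov_seq_product o x y ij)%:E)
  (filter_prod \oo \oo))%E.
  by apply: (lt_le_trans rab); apply: ereal_inf_lbound; exists x, y.
rewrite limf_einfE => /ereal_sup_gt[_ [V /near_prodP[N VN] <-]] rV.
exists N => i j iN jN; rewrite -lee_fin; apply: (le_trans (ltW rV)).
by apply: ereal_inf_lbound; exists (i, j) => //; exact: VN.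
Qed.

Lemma boundary_product_ge o a b (r : R) :
  (forall x y, converges_to x a -> converges_to y b ->
    exists N, forall i j, (N <= i)%N -> (N <= j)%N ->
      r <= gromov_product o (x i) (y j)) ->
  (r%:E <= boundary_product o a b)%E.
Proof.
move=> h; apply: le_ereal_inf_tmp => _ [x [y [xa yb ->]]].
have [N HN] := h x y xa yb.
rewrite limf_einfE; apply: le_trans; last first.
  apply: ereal_sup_ubound; exists [set ij | (N <= ij.1)%N /\ (N <= ij.2)%N].
    by apply/near_prodP; exists N.
  reflexivity.
apply: le_ereal_inf_tmp => _ [[i j] /= [iN jN] <-].
by rewrite lee_fin; exact: HN.
Qed.

Lemma boundary_product_diag o a : boundary_product o a a = +oo%E.
Proof.
apply/eqyP => M _; apply: boundary_product_ge => x y xa ya.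
by have /gromov_pinftyP/(_ M) := converges_to_sim xa ya o.
Qed.

Lemma boundary_product_hyp : exists2 d : R, 0 <= d &
  forall o a b c r, (r%:E < boundary_product o a b)%E ->
    (r%:E < boundary_product o b c)%E ->
    ((r - d)%:E <= boundary_product o a c)%E.
Proof.
have [d d0 hyp] := @hyperbolic_gromov R S; exists d => // o a b c r ab bc.
apply: boundary_product_ge => x z xa zc.
have [y yb] := converges_to_ex b.
have [N1 HN1] := boundary_productP ab xa yb.
have [N2 HN2] := boundary_productP bc yb zc.
exists (maxn N1 N2) => i j; rewrite !geq_max => /andP[i1 i2] /andP[j1 j2].
pose k := maxn N1 N2.
have h1 := HN1 i k i1 (leq_maxl _ _).
have h2 := HN2 k j (leq_maxr _ _) j2.
apply: le_trans (hyp (x i) (z j) (y k) o).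
by rewrite lerB // le_min h1.
Qed.

Lemma boundary_product_base o o' a b (r : R) :
  (r%:E < boundary_product o a b)%E ->
  ((r - mdist o o')%:E <= boundary_product o' a b)%E.
Proof.
move=> ab; apply: boundary_product_ge => x y xa yb.
have [N HN] := boundary_productP ab xa yb; exists N => i j iN jN.
have := HN i j iN jN; have := gromov_product_base o o' (x i) (y j); lra.
Qed.

Lemma boundary_nbhs_base o a (A : set (boundary S)) :
  nbhs a A <-> exists2 r : R, 0 <= r &
    [set b | (r%:E < boundary_product o a b)%E] `<=` A.
Proof.
change (nbhs a A) with (boundary_nbhs a A).
split=> [h|[r r0 rA] o']; first exact: (h o).
exists (r + mdist o o' + 1) => [|b /= ab].
  by rewrite !addr_ge0 // mdist_ge0.
apply: rA => /=; apply: lt_le_trans (boundary_product_base o ab).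
rewrite lte_fin (metric_sym o'); lra.
Qed.

Fact boundary_nbhs_filter a : ProperFilter (nbhs a).
Proof.
apply: Build_ProperFilter_ex => [A aA|].
  have [x _] := converges_to_ex a.
  have [r _ rA] := (boundary_nbhs_base (x 0%N) a A).1 aA.
  by exists a; apply: rA; rewrite /= boundary_product_diag ltry.
change (Filter (boundary_nbhs a)); split=> [|A B aA aB o|A B AB aA o].
- by move=> o; exists 0.
- have [r r0 rA] := aA o; have [s s0 sB] := aB o.
  exists (Num.max r s) => [|b]; first by rewrite le_max r0.
  by rewrite /= EFin_max gt_max => /andP[/rA Ab /sB Bb].
- by have [r r0 rA] := aA o; exists r => // b /rA /AB.
Qed.

Fact boundary_nbhs_singleton a (A : set (boundary S)) : nbhs a A -> A a.
Proof.
have [x _] := converges_to_ex a.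
move=> /(boundary_nbhs_base (x 0%N))[r _]; apply.
by rewrite /= boundary_product_diag ltry.
Qed.

Fact boundary_nbhs_nbhs a (A : set (boundary S)) :
  nbhs a A -> nbhs a (nbhs^~ A).
Proof.
have [x _] := converges_to_ex a; pose o := x 0%N.
move=> /(boundary_nbhs_base o)[r r0 rA]; apply/(boundary_nbhs_base o).
have [d d0 hyp] := boundary_product_hyp.
exists (r + d + 1) => [|b /= ab]; first by rewrite !addr_ge0.
apply/(boundary_nbhs_base o); exists (r + d + 1) => [|c /= bc].
  by rewrite !addr_ge0.
apply: rA => /=; apply: lt_le_trans (hyp _ _ _ _ _ ab bc).
rewrite lte_fin; lra.
Qed.

End BoundaryTheory.

HB.instance Definition _ (R : realType) (S : hyperbolicType R) :=
  Nbhs_isNbhsTopological.Build (boundary S)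
    (@boundary_nbhs_filter R S) (@boundary_nbhs_singleton R S)
    (@boundary_nbhs_nbhs R S).

Section Groups.
Context {G : groupType}.
Implicit Types (g h : G) (H N : set G).
Local Open Scope group_scope.

Definition subgroup H : Prop :=
  H 1 /\ forall g h, H g -> H h -> H (g / h).

Definition normal_subgroup N H : Prop :=
  [/\ subgroup N, N `<=` H & forall n h, N n -> H h -> N (n ^ h)].

Definition simple_subgroup H : Prop :=
  [/\ subgroup H, H <> [set 1] &
      forall N, normal_subgroup N H -> N = [set 1] \/ N = H].

Definition cyclic_subgroup g : set G :=
  [set h | exists n : nat, h = g ^+ n \/ h = g ^- n].

Definition monolith : set G :=
  \bigcap_(N in [set N | normal_subgroup N setT /\ N <> [set 1]]) N.

Definition monolithic : Prop := monolith <> [set 1].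

Definition fixed_points {X : Type} (act : G -> X -> X) H : set X :=
  [set p | forall h, H h -> act h p = p].

Definition group_orbit {X : Type} (act : G -> X -> X) H (p : X) : set X :=
  [set act h p | h in H].

Definition faithful_action {X : Type} (act : G -> X -> X) : Prop :=
  forall g, (forall p, act g p = p) -> g = 1.

Definition topologically_free {X : topologicalType} (act : G -> X -> X) :
    Prop :=
  forall g, g <> 1 -> interior (fixed_points act [set g]) = set0.

End Groups.
Arguments monolith G : clear implicits.
Arguments monolithic G : clear implicits.

Record isometric_action (G : groupType) (R : realType) (S : metricType R) :=
  IsometricAction {
    isom_act :> G -> S -> S;
    isom_act1 : forall s, isom_act 1%g s = s;
    isom_actM : forall g h s, isom_act (g * h)%g s = isom_act g (isom_act h s);
    isom_act_isometry :
      forall g s t, mdist (isom_act g s) (isom_act g t) = mdist s t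
  }.

Section Actions.
Context {G : groupType} {R : realType} {S : hyperbolicType R}.
Variable rho : isometric_action G S.
Implicit Types (g h : G) (x y : nat -> S) (a : boundary S).

Lemma isom_actK g : cancel (rho g) (rho g^-1%g).
Proof. by move=> s; rewrite -isom_actM mulVg isom_act1. Qed.

Lemma isom_actVK g : cancel (rho g^-1%g) (rho g).
Proof. by move=> s; rewrite -isom_actM mulgV isom_act1. Qed.

Lemma gromov_sim_act g x y :
  gromov_sim x y -> gromov_sim (rho g \o x) (rho g \o y).
Proof.
move=> xy o; apply/gromov_pinftyP => M.
have /gromov_pinftyP/(_ M)[N HN] := xy (rho g^-1%g o).
exists N => i j iN jN; have := HN i j iN jN.
have rhoV u : mdist u (rho g^-1%g o) = mdist (rho g u) o.
  by rewrite -(isom_act_isometry rho g) isom_actVK.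
by rewrite /gromov_product /= !rhoV isom_act_isometry.
Qed.

Fact boundary_act_subproof g a :
  exists2 x, gromov_sequence x &
    [set rho g \o y | y in boundary_class a] = gromov_class x.
Proof.
have [x xx ->] := boundary_classP a.
exists (rho g \o x); first exact: gromov_sim_act.
apply/seteqP; split=> [_ [y [yy xy] <-]|y [yy xy]].
  by split; exact: gromov_sim_act.
exists (rho g^-1%g \o y).
  split; first exact: gromov_sim_act.
  have -> : x = rho g^-1%g \o (rho g \o x).
    by apply/funext => i /=; rewrite isom_actK.
  exact: gromov_sim_act.
by apply/funext => i /=; rewrite isom_actVK.
Qed.

Definition boundary_act g a : boundary S :=
  Boundary (boundary_act_subproof g a).

Definition limit_set : set (boundary S) :=
  [set a | exists s x, (forall i, group_orbit rho setT s (x i)) /\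
                       converges_to x a].

Fact limit_act_subproof g (p : limit_set) :
  boundary_act g (\val p) \in limit_set.
Proof.
apply/mem_set; have /set_mem[s [x [xs xp]]] := valP p.
exists s, (rho g \o x); split=> [i|]; last by exists x.
by have [h _ hs] := xs i; exists (g * h)%g; rewrite //= isom_actM hs.
Qed.

(* set_type carries the subspace topology *)
Definition limit_act g (p : limit_set) : limit_set :=
  exist _ (boundary_act g (\val p)) (limit_act_subproof g p).

Definition unbounded_orbits (H : set G) : Prop :=
  forall s, ~ metric_bounded (group_orbit rho H s).

Definition loxodromic g : Prop :=
  unbounded_orbits (cyclic_subgroup g) /\
  exists a b, a <> b /\
    fixed_points boundary_act (cyclic_subgroup g) = [set a; b].

Definition general_type : Prop :=
  unbounded_orbits setT /\
  exists g h, [/\ loxodromic g, loxodromic h &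
    fixed_points boundary_act [set g] `&` fixed_points boundary_act [set h]
      = set0].

End Actions.
Arguments limit_set {G R S} rho.
Arguments limit_act {G R S} rho g p.
Arguments general_type {G R S} rho.

Definition faithful_weakly_hyperbolic (R : realType) (G : groupType) : Prop :=
  exists (S : hyperbolicType R) (rho : isometric_action G S),
    general_type rho /\ faithful_action (limit_act rho).

Definition lim_free (R : realType) (G : groupType) : Prop :=
  exists (S : hyperbolicType R) (rho : isometric_action G S),
    general_type rho /\ topologically_free (limit_act rho).

(* Main.v *)
(* Call an action on a Hausdorff space extremely proximal if the complement of
   any nonempty open set can be moved into any other nonempty open set.  Suppose
   a faithful action of [G] is extremely proximal but not topologically free.  A
   nontrivial element fixing an open set pointwise has conjugates supported in
   any nonempty open set.  If [N] is a nontrivial normal subgroup and [n] in [N]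
   displaces [V], then for [f1], [f2] supported in [V] the commutator [~ f1, f2]
   does not change when [f1] is replaced by its commutator with [n], so it lies
   in [N].  By proximality [N] contains the commutators of elements supported
   off any given nonempty open set.  Hence the monolith [M] has nontrivial
   elements of arbitrarily small support, and is infinite.  It is itself
   extremely proximal, so the same argument inside [M] shows that all conjugates
   of a nontrivial normal subgroup of [M] share a nontrivial commutator; their
   intersection is normal in [G], hence contains [M].

   The action on the limit set is extremely proximal because
   <g x|g o>_o = d(o, g o) - <x|g^-1 o>_o: an element [g] with [g o] close to
   [b] and [g^-1 o] close to [a] moves everything not close to [a] close to [b].
   Such a [g] is found as u k v^-1 with u o -> b, v o -> a and [k] one of three
   elements, chosen to keep [k v^-1 o] and [u^-1 o] apart. *)

Require Import Defs.
From mathcomp Require Import all_boot all_order all_algebra.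
From mathcomp Require Import all_classical all_reals all_analysis.
From mathcomp Require Import lra.

Set Implicit Arguments.
Unset Strict Implicit.
Unset Printing Implicit Defensive.

Import Order.TTheory GRing.Theory Num.Theory.

Local Open Scope classical_set_scope.

(** * Extremely proximal actions *)

Section Subgroups.
Context {G : groupType}.
Implicit Types (f g h n : G) (H N : set G).
Local Open Scope group_scope.

Lemma subgroupV H g : subgroup H -> H g -> H g^-1.
Proof. by move=> [H1 HB] Hg; have := HB _ _ H1 Hg; rewrite mul1g. Qed.

Lemma subgroupM H g h : subgroup H -> H g -> H h -> H (g * h).
Proof.
move=> sH Hg Hh; have := sH.2 _ _ Hg (subgroupV sH Hh).
by rewrite invgK.
Qed.

Lemma subgroupJ H g h : subgroup H -> H g -> H h -> H (g ^ h).
Proof.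
by move=> sH Hg Hh; rewrite conjgE; do 2?apply: subgroupM => //;
  apply: subgroupV.
Qed.

Lemma subgroupR H g h : subgroup H -> H g -> H h -> H [~ g, h].
Proof.
move=> sH Hg Hh; rewrite commgEl; apply: subgroupM => //.
  exact: subgroupV.
exact: subgroupJ.
Qed.

Lemma subgroupT : subgroup [set: G].
Proof. by []. Qed.

Lemma subgroup_neq1 H : subgroup H -> H <> [set 1] ->
  exists2 g, H g & g <> 1.
Proof.
move=> [H1 _] Hn1; apply: contrapT => h; apply: Hn1.
apply/seteqP; split=> [g Hg /=|_ ->//].
by apply: contrapT => g1; apply: h; exists g.
Qed.

Lemma monolith_normal : normal_subgroup (monolith G) setT.
Proof.
split=> //; first split=> [N [[[N1 _] _ _] _]//|g h Mg Mh N nN].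
  by case: (nN) => -[[_ NB] _ _] _; apply: NB; [exact: Mg|exact: Mh].
move=> g h Mg _ N nN; case: (nN) => -[_ _ NJ] _; apply: NJ => //; exact: Mg.
Qed.

Lemma monolith_sub N :
  normal_subgroup N setT -> N <> [set 1] -> monolith G `<=` N.
Proof. by move=> nN N1 g; apply. Qed.

(* The commutator does not change when [f1] is multiplied by something commuting
   with [f1] and [f2], in particular when it is replaced by
   [f1 n f1^-1 n^-1], which is in [N]. *)
Lemma commg_normal N H n f1 f2 : normal_subgroup N H -> N n -> H f1 -> H f2 ->
  subgroup H ->
  commute (f1^-1 ^ n^-1) f1 -> commute (f1^-1 ^ n^-1) f2 -> N [~ f1, f2].
Proof.
move=> [sN NH NJ] Nn Hf1 Hf2 sH; set e := _ ^ _ => ef1 ef2.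
have Nt : N (f1 * e).
  rewrite (_ : f1 * e = n ^ f1^-1 * n^-1); last first.
    by rewrite /e !conjgE !invgK !mulgA.
  apply: subgroupM => //; first by apply: NJ => //; exact: subgroupV.
  exact: subgroupV.
have : N [~ f1 * e, f2].
  rewrite commgEl; apply: subgroupM => //; last exact: NJ.
  exact: subgroupV.
suff -> : [~ f1 * e, f2] = [~ f1, f2] by [].
clearbody e.
have eR : commute e [~ f1, f2].
  by rewrite commgEl conjgE; repeat (apply: commuteM || apply: commuteV).
have -> : [~ f1 * e, f2] = e^-1 * ([~ f1, f2] * e).
  rewrite !commgEl !conjgE invgM.
  have -> : f1 * e * f2 = f1 * f2 * e by rewrite -!mulgA ef2.
  by rewrite !mulgA.
by rewrite -eR mulKg.
Qed.

End Subgroups.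

(** * Supports, and open sets displaced by an element *)

Section ExtremelyProximal.
Context {G : groupType} {X : topologicalType} (act : G -> X -> X).
Implicit Types (f g h k n : G) (H N : set G) (x y : X) (U V W O : set X).
Local Open Scope group_scope.

Definition rigid_stabilizer V : set G :=
  [set g | forall x, ~ V x -> act g x = x].

Definition extremely_proximal H : Prop :=
  forall A B : set X, open A -> open B -> A !=set0 -> B !=set0 ->
    exists2 h, H h & forall x, ~ A x -> B (act h x).

Context (act1 : forall x, act 1 x = x)
  (actM : forall g h x, act (g * h) x = act g (act h x)).

Let actK g x : act g^-1 (act g x) = x.
Proof. by rewrite -actM mulVg act1. Qed.

Let actKV g x : act g (act g^-1 x) = x.
Proof. by rewrite -actM mulgV act1. Qed.

Lemma rigid_stabilizer_subgroup V : subgroup (rigid_stabilizer V).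
Proof.
split=> [x _|g h gV hV x Vx]; first exact: act1.
by rewrite actM -{1}(hV _ Vx) actK gV.
Qed.

Lemma rigid_stabilizer_sub V W :
  V `<=` W -> rigid_stabilizer V `<=` rigid_stabilizer W.
Proof. by move=> VW g gV x Wx; apply: gV => /VW. Qed.

Lemma rigid_stabilizer_stable V g x :
  rigid_stabilizer V g -> V x -> V (act g x).
Proof.
move=> gV Vx; apply: contrapT => nV; apply: (nV).
by have /(congr1 (act g^-1)) := gV _ nV; rewrite !actK => ->.
Qed.

(** As [f ^ h^-1] is [h * f * h^-1], its support is the image under [h] of that of [f]. *)
Lemma rigid_stabilizerJ V W f h : rigid_stabilizer V f ->
  (forall x, V x -> W (act h x)) -> rigid_stabilizer W (f ^ h^-1).
Proof.
move=> fV VW x Wx; rewrite conjgE invgK !actM fV ?actKV// => /VW.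
by rewrite actKV.
Qed.

Context (act_faithful : faithful_action act).

Lemma act_moves g : g <> 1 -> exists x, act g x <> x.
Proof.
move=> g1; apply: contrapT => h; apply/g1/act_faithful => x.
by apply: contrapT => gx; apply: h; exists x.
Qed.

Lemma rigid_stabilizer_commute V W f g : V `&` W = set0 ->
  rigid_stabilizer V f -> rigid_stabilizer W g -> commute f g.
Proof.
move=> VW fV gW; suff : [~ f, g] = 1 by move=> /eqP/commgP.
have nVW x : V x -> ~ W x by move=> Vx Wx; suff: (V `&` W) x by rewrite VW.
have fg x : act (f * g) x = act (g * f) x.
  rewrite !actM; have [Vx|Vx] := pselect (V x).
    by rewrite !gW//; apply: nVW => //; exact: rigid_stabilizer_stable.
  rewrite (fV _ Vx); have [Wx|Wx] := pselect (W x); last by rewrite gW ?fV.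
  rewrite fV// => /nVW; apply; exact: rigid_stabilizer_stable.
apply: act_faithful => x.
have -> : [~ f, g] = (g * f)^-1 * (f * g).
  by rewrite commgEl conjgE invgM !mulgA.
by rewrite actM fg actK.
Qed.

(** The factor [f1^-1 ^ n^-1] of [commg_normal] is supported in the image of [V] under [n], which is
    disjoint from [V]. *)
Lemma commg_rigid_stabilizer N H n V f1 f2 : subgroup H ->
  normal_subgroup N H -> N n ->
  (forall x, V x -> ~ V (act n x)) ->
  H f1 -> H f2 -> rigid_stabilizer V f1 -> rigid_stabilizer V f2 ->
  N [~ f1, f2].
Proof.
move=> sH nN Nn nV Hf1 Hf2 f1V f2V.
have eW : rigid_stabilizer (act n @` V) (f1^-1 ^ n^-1).
  apply: (@rigid_stabilizerJ V) => [|x Vx]; last by exists x.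
  exact: subgroupV (rigid_stabilizer_subgroup V) _.
have VW : (act n @` V) `&` V = set0.
  by apply/seteqP; split=> // _ [[x Vx <-]] /(nV _ Vx).
by apply: (commg_normal nN Nn) => //; apply: rigid_stabilizer_commute VW eW _.
Qed.

Context (act_continuous : forall g, continuous (act g))
  (hausdorffX : hausdorff_space X).

Lemma separating_open g V x : open V -> V x -> act g x <> x ->
  exists W, [/\ open W, W x, W `<=` V & forall y, W y -> ~ W (act g y)].
Proof.
move=> oV Vx gx.
have := hausdorffX; rewrite open_hausdorff => /(_ (act g x) x).
have /eqP gx' := gx; move=> /(_ gx')[[A B]] /= [/set_mem Ax /set_mem Bx].
move=> [oA oB /eqP AB].
exists (V `&` B `&` act g @^-1` A); split=> //.
- apply: openI; first exact: openI.
  by apply: open_comp => // y _; exact: act_continuous.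
- by move=> y [[]].
- move=> y [_ Ay] [[_ By] _].
  by have : (A `&` B) (act g y) by []; rewrite AB.
Qed.

Lemma open_act_preimage g V : open V -> open (act g @^-1` V).
Proof. by move=> oV; apply: open_comp => // y _; exact: act_continuous. Qed.

Lemma act_preimage_neq0 g V : V !=set0 -> (act g @^-1` V) !=set0.
Proof. by move=> [x Vx]; exists (act g^-1 x); rewrite /preimage /= actKV. Qed.

(** Some [h] in [H] maps the complement of [O] into a set displaced by an element of [N].
    Conjugation by [h] keeps the pair in [H] and reduces to [commg_rigid_stabilizer]. *)
Lemma commg_rigid_stabilizer_proximal N H O f1 f2 : subgroup H ->
  extremely_proximal H -> normal_subgroup N H -> N <> [set 1] ->
  open O -> O !=set0 -> H f1 -> H f2 ->
  rigid_stabilizer (~` O) f1 -> rigid_stabilizer (~` O) f2 -> N [~ f1, f2].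
Proof.
move=> sH epH nN N1 oO O0 Hf1 Hf2 f1O f2O.
have [sN NH NJ] := nN.
have [n Nn /act_moves[x nx]] := subgroup_neq1 sN N1.
have [V [oV Vx _ nV]] := separating_open openT I nx.
have V0 : V !=set0 by exists x.
have [h Hh hOV] := epH _ _ oO oV O0 V0.
have HV : H h^-1 by exact: subgroupV.
rewrite -(conjgKV h [~ _, _]); apply: NJ => //.
rewrite conjRg; apply: (@commg_rigid_stabilizer _ _ _ V _ _ sH nN Nn nV).
- exact: subgroupJ.
- exact: subgroupJ.
- exact: rigid_stabilizerJ f1O _.
- exact: rigid_stabilizerJ f2O _.
Qed.

(** * Subgroups with elements of arbitrarily small support *)

Definition micro_supported H : Prop := forall V, open V -> V !=set0 ->
  exists2 h, H h & rigid_stabilizer V h /\ h <> 1.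

Lemma micro_supported_noncommuting H V : micro_supported H ->
  open V -> V !=set0 ->
  exists O, [/\ open O, O !=set0 & exists f1 f2,
    [/\ H f1 /\ H f2, rigid_stabilizer V f1 /\ rigid_stabilizer V f2,
      rigid_stabilizer (~` O) f1 /\ rigid_stabilizer (~` O) f2 &
      [~ f1, f2] <> 1]].
Proof.
move=> msH.
(* [k] displaces [W], on which a smaller pair will then be supported *)
have shrink U : open U -> U !=set0 -> exists k W,
    [/\ H k /\ rigid_stabilizer U k, open W, W !=set0, W `<=` U &
      forall y, W y -> ~ W (act k y)].
  move=> oU U0; have [k Hk [kU /act_moves[x kx]]] := msH _ oU U0.
  have Ux : U x by apply: contrapT => /kU.
  have [W [oW Wx WU kW]] := separating_open oU Ux kx.
  by exists k, W; split=> //; exists x.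
move=> oV V0.
have [k [W [_ oW W0 WV kW]]] := shrink _ oV V0.
have [f1 [W' [[Hf1 f1W] oW' W'0 W'W f1W']]] := shrink _ oW W0.
have [f2 Hf2 [f2W' f2n1]] := msH _ oW' W'0.
(* This is the image of [W] under [k]. It is disjoint from [W], where [f1] and [f2] are
   supported. *)
exists (act k^-1 @^-1` W); split; [exact: open_act_preimage|
  exact: act_preimage_neq0|].
have WO : W `<=` ~` (act k^-1 @^-1` W).
  by move=> y Wy /= /kW; rewrite actKV.
have f2W := rigid_stabilizer_sub W'W f2W'.
exists f1, f2; split=> //.
- by split; [apply: rigid_stabilizer_sub f1W|apply: rigid_stabilizer_sub f2W].
- by split; [apply: rigid_stabilizer_sub f1W|apply: rigid_stabilizer_sub f2W].
(* [f1] moves each point of [W'] off the support of [f2], so commuting would make [f2] trivial on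
   [W'] as well. *)
move=> /eqP/commgP f12.
have [x f2x] := act_moves f2n1.
have W'x : W' x by apply: contrapT => /f2W'.
have := f2W' _ (f1W' _ W'x).
rewrite -actM -f12 actM => /(congr1 (act f1^-1)); rewrite !actK.
exact: f2x.
Qed.

(** * The monolith of an extremely proximal action *)

Context (act_proximal : extremely_proximal setT)
  (act_not_free : ~ topologically_free act).

Lemma micro_supportedT : micro_supported setT.
Proof.
move=> V oV V0; apply: contrapT => nV; apply: act_not_free => g g1.
apply/seteqP; split=> // x gx; apply: nV.
have F0 : (fixed_points act [set g])° !=set0 by exists x.
have [h _ hV] := act_proximal (open_interior _) oV F0 V0.
exists (g ^ h^-1) => //; split; last first.
  by move=> /eqP; rewrite conjg_eq1 => /eqP.
apply: (@rigid_stabilizerJ (~` (fixed_points act [set g])°)) => // y.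
by move=> /contrapT/interior_subset; apply.
Qed.

(* [g k g^-1 k^-1] maps the complement of [O] successively into the complement
   of [k^-1 O], into [A], into the complement of [A], and into [V]. *)
Lemma normal_proximal_step N k V O : normal_subgroup N setT -> N k -> k <> 1 ->
  open V -> open O -> (V `&` act k @^-1` O) !=set0 ->
  exists2 m, N m & forall x, ~ O x -> (V `&` act k @^-1` O) (act m x).
Proof.
move=> [sN _ NJ] Nk /act_moves[p kp] oV oO VO0.
have [A [oA Ap _ kA]] := separating_open openT I kp.
have oB : open (V `&` act k @^-1` O).
  by apply: openI => //; exact: open_act_preimage.
have A0 : A !=set0 by exists p.
have [g _ gAB] := act_proximal oA oB A0 VO0.
exists (k ^ g^-1 * k^-1) => [|x Ox].
  by apply: subgroupM; [|exact: NJ|exact: subgroupV].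
rewrite conjgE invgK !actM; apply/gAB/kA; apply: contrapT => /gAB.
by rewrite actKV => -[_] /=; rewrite actKV.
Qed.

Lemma normal_proximal N : normal_subgroup N setT -> N <> [set 1] ->
  micro_supported N -> extremely_proximal N.
Proof.
move=> nN N1 msN O V oO oV O0 V0.
have [sN _ _] := nN.
suff [k [Nk k1 kVO]] : exists k, [/\ N k, k <> 1 &
    (V `&` act k @^-1` O) !=set0].
  have [m Nm mOV] := normal_proximal_step nN Nk k1 oV oO kVO.
  by exists m => // x /mOV[].
have [[x [Vx Ox]]|VO] := pselect ((V `&` O) !=set0).
  have [|k Nk [kVO k1]] := msN _ (openI oV oO); first by exists x.
  exists k; split=> //; exists x; split=> //=.
  by have [] := rigid_stabilizer_stable kVO (conj Vx Ox).
(* If this [k] fails, the preimage of [O] under [k] misses [V]. An [m] in [N] maps the complement of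
   [O] into that preimage, so [m^-1] maps [V] into [O]. *)
have [k Nk k1] := subgroup_neq1 sN N1.
have [kVO|kVO] := pselect ((V `&` act k @^-1` O) !=set0); first by exists k.
have TO : (setT `&` act k @^-1` O) !=set0.
  by rewrite setTI; exact: act_preimage_neq0.
have [m Nm mO] := normal_proximal_step nN Nk k1 openT oO TO.
have [x Vx] := V0.
have mV : O (act m^-1 x).
  apply: contrapT => /mO; rewrite setTI actKV => kx.
  by apply: kVO; exists x.
exists m^-1; split; [exact: subgroupV| |by exists x].
by move=> m1; apply: VO; exists x; split=> //; rewrite -(act1 x) -m1.
Qed.

(** Elements supported in a set [W] displaced by [k] preserve [W], hence differ from [k]. So each
    shrinking of the open set removes an entry from a finite list of the elements supported
    there. *)
Lemma micro_supported_infinite H (V : set X) : micro_supported H ->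
  V !=set0 -> open V -> infinite_set H.
Proof.
move=> msH V0 oV /finite_seqP[s Hs].
suff : forall (i : nat) (r : seq G) V, open V -> V !=set0 -> (size r <= i)%N ->
    ~ (forall g, H g -> rigid_stabilizer V g -> g <> 1 -> g \in r).
  move=> /(_ (size s) s V oV V0 (leqnn _)); apply=> g Hg _ _.
  by move: Hg; rewrite Hs.
elim=> [|i IHi] r {s Hs}{}V {}oV {}V0 ri Hr.
  have [k Hk [kV k1]] := msH _ oV V0.
  by have := Hr _ Hk kV k1; move: ri; rewrite leqn0 => /nilP ->.
have [k Hk [kV k1]] := msH _ oV V0.
have [x kx] := act_moves k1.
have Vx : V x by apply: contrapT => /kV.
have [W [oW Wx WV kW]] := separating_open oV Vx kx.
have W0 : W !=set0 by exists x.
apply: (IHi (rem k r) W oW W0).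
  by rewrite size_rem ?Hr// -subn1 leq_subLR add1n.
move=> g Hg gW g1.
have rg : g \in r by apply: Hr => //; apply: rigid_stabilizer_sub gW.
suff gk : g != k.
  by rewrite (perm_mem (perm_to_rem (Hr _ Hk kV k1))) inE (negPf gk) in rg.
apply/eqP => gk; apply: (kW _ Wx); rewrite -gk.
exact: rigid_stabilizer_stable.
Qed.

(** The commutator is chosen before [N], so the same one lies in every nontrivial normal
    subgroup. *)
Lemma monolith_micro_supported : micro_supported (monolith G).
Proof.
move=> V oV V0.
have [U [oU U0 [f1 [f2 [_ [f1V f2V] [f1O f2O] f12]]]]] :=
  micro_supported_noncommuting micro_supportedT oV V0.
exists [~ f1, f2]; last first.
  by split=> //; exact: subgroupR (rigid_stabilizer_subgroup V) f1V f2V.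
move=> N [nN N1].
exact: (commg_rigid_stabilizer_proximal subgroupT act_proximal nN N1 oU U0).
Qed.

Theorem proximal_monolith :
  monolithic G /\ infinite_set (monolith G) /\ simple_subgroup (monolith G).
Proof.
have [V oV V0] : exists2 V : set X, open V & V !=set0.
  apply: contrapT => nV; apply: act_not_free => g _.
  apply/seteqP; split=> // x gx; apply: nV.
  by exists (fixed_points act [set g])°; [exact: open_interior|exists x].
have msM := monolith_micro_supported.
have iM := micro_supported_infinite msM V0 oV.
have M1 : monolith G <> [set 1].
  by move=> M1; apply: iM; rewrite M1; apply: finite_set1.
have nM := @monolith_normal G; have [sM _ _] := nM.
have epM := normal_proximal nM M1 msM.
split=> //; split=> //; split=> // N nN.
have [->|N1] := pselect (N = [set 1]); [by left|right].
have [sN NM NJ] := nN.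
(* the normal core of [N] is again nontrivial, because all conjugates of [N]
   contain the same commutators *)
pose K : set G := [set k | forall g, N (k ^ g)].
apply/seteqP; split=> //; suff MK : monolith G `<=` K.
  by move=> g /MK/(_ 1); rewrite conjg1.
apply: monolith_sub.
  split=> //; first split=> [g|g h Kg Kh t].
  - by rewrite conj1g; exact: sN.1.
  - by rewrite conjMg conjVg; exact: sN.2.
  - by move=> g h Kg _ t; rewrite -conjgM.
have [U [oU U0 [f1 [f2 [[Mf1 Mf2] _ [f1O f2O] f12]]]]] :=
  micro_supported_noncommuting msM oV V0.
move=> K1; apply: f12; suff : K [~ f1, f2] by rewrite K1.
move=> g.
have nNg : normal_subgroup [set h | N (h ^ g)] (monolith G).
  split; first split=> [|h t /= Nh Nt].
  - by rewrite /= conj1g; exact: sN.1.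
  - by rewrite conjMg conjVg; exact: sN.2.
  - move=> h /= /NM Mh; rewrite -(conjgK g h).
    by have [_ _ MJ] := nM; exact: MJ.
  - move=> h t /= Nh Mt; rewrite conjJg; apply: NJ => //.
    by have [_ _ MJ] := nM; exact: MJ.
apply: (commg_rigid_stabilizer_proximal sM epM nNg) oU U0 _ _ _ _ => //.
move=> Ng1; apply: N1; apply/seteqP; split=> [h Nh|_ ->]; last exact: sN.1.
have : [set h | N (h ^ g)] (h ^ g^-1) by rewrite /= conjgKV.
by rewrite Ng1 /= => /eqP; rewrite conjg_eq1 => /eqP.
Qed.

End ExtremelyProximal.

(** * Actions of general type *)

Section GromovProduct.
Context {R : realType} {S : hyperbolicType R}.
Implicit Types (o s u v w : S) (x y z : nat -> S) (a b c : boundary S) (r : R).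
Local Open Scope ring_scope.

Lemma gromov_product_ge0 o u v : 0 <= gromov_product o u v.
Proof.
by rewrite /gromov_product; have := metric_triangle u o v;
  rewrite (metric_sym o v); lra.
Qed.

Lemma gromov_product_le o u v : gromov_product o u v <= mdist o u.
Proof.
by rewrite /gromov_product; have := metric_triangle v u o;
  rewrite (metric_sym o u) (metric_sym v u); lra.
Qed.

Lemma gromov_product_diag o u : gromov_product o u u = mdist o u.
Proof.
by rewrite /gromov_product mdistxx (metric_sym o u); lra.
Qed.

(** Threshold form of hyperbolicity for chaining estimates: each intermediate point costs [d]. *)
Lemma gromov_product_hyp : exists2 d : R, 0 <= d &
  forall o u v w r, r <= gromov_product o u w -> r <= gromov_product o w v ->
    r - d <= gromov_product o u v.
Proof.
have [d d0 hyp] := @hyperbolic_gromov R S; exists d => // o u v w r h1 h2.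
by apply: le_trans (hyp u v w o); rewrite lerB// le_min h1.
Qed.

(* For [x] converging to [a] this says that [<u|a>_o >= r], up to a bounded
   error. *)
Definition eventually_ge o u x r : Prop :=
  exists N, forall i, (N <= i)%N -> r <= gromov_product o u (x i).

Lemma converges_to_sim_eq x y a b :
  converges_to x a -> converges_to y b -> gromov_sim x y -> a = b.
Proof.
case: a b => [A PA] [B PB]; rewrite /converges_to /= => Ax By xy.
suff AB : A = B.
  by case: B / AB PB {By} => PB; congr Boundary; exact: Prop_irrelevance.
have [x0 _ EA] := PA; have [y0 _ EB] := PB; move: Ax By.
rewrite EA EB => -[_ x0x] [_ y0y]; apply/seteqP.
have x0y0 : gromov_sim x0 y0.
  exact: gromov_sim_trans x0x (gromov_sim_trans xy (gromov_sim_sym y0y)).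
split=> t [tt' h]; split=> //.
  exact: gromov_sim_trans (gromov_sim_sym x0y0) h.
exact: gromov_sim_trans x0y0 h.
Qed.

Lemma sim_ge o x y r : gromov_sim x y ->
  exists N, forall i j, (N <= i)%N -> (N <= j)%N ->
    r <= gromov_product o (x i) (y j).
Proof. by move=> /(_ o)/gromov_pinftyP/(_ r). Qed.

(** Inequivalence only bounds the product at some arbitrarily late indices [k], [l]. The chain
    [x k], [x i], [y j], [y l] carries this bound over to all late [i], [j] at the cost of
    [2 * d]. *)
Lemma distinct_product_bounded o x y a b : converges_to x a ->
  converges_to y b -> a <> b ->
  exists2 L, 0 <= L & exists N, forall i j, (N <= i)%N -> (N <= j)%N ->
    gromov_product o (x i) (y j) <= L.
Proof.
move=> xa yb ab; have [d d0 hyp] := gromov_product_hyp.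
have [M HM] : exists M, forall N, exists i j,
    [/\ (N <= i)%N, (N <= j)%N & gromov_product o (x i) (y j) < M].
  apply: contrapT => h; apply: ab; apply: (converges_to_sim_eq xa yb).
  apply: (@gromov_sim_base _ _ o); apply/gromov_pinftyP => M.
  apply: contrapT => h'; apply: h; exists M => N.
  apply: contrapT => h; apply: h'; exists N => i j iN jN.
  by rewrite leNgt; apply/negP => ltM; apply: h; exists i, j.
pose L := Num.max M 0 + d + d.
have [N1 HN1] := sim_ge o L (converges_to_seq xa).
have [N2 HN2] := sim_ge o L (converges_to_seq yb).
have ML : M <= Num.max M 0 /\ 0 <= Num.max M 0 by rewrite !le_max !lexx orbT.
exists L; first by rewrite !addr_ge0//; case: ML.
exists (maxn N1 N2) => i j; rewrite !geq_max => /andP[i1 i2] /andP[j1 j2].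
have [k [l [kN lN Hkl]]] := HM (maxn N1 N2).
move: kN lN; rewrite !geq_max => /andP[k1 k2] /andP[l1 l2].
rewrite leNgt; apply/negP => /ltW h.
have h1 := hyp _ _ _ _ _ (HN1 k i k1 i1) h.
have h2 : L - d <= gromov_product o (y j) (y l).
  by have := HN2 j l j2 l2; lra.
have := hyp _ _ _ _ _ h1 h2; rewrite /L; case: ML; lra.
Qed.

End GromovProduct.

(** * Orbit points near fixed boundary points, and transverse loxodromic elements *)

Section Isometries.
Context {G : groupType} {R : realType} {S : hyperbolicType R}.
Variable rho : isometric_action G S.
Implicit Types (g h k p q : G) (o u v s : S) (x y : nat -> S).
Implicit Types (a b : boundary S).
Local Open Scope ring_scope.

Lemma gromov_product_act g o u v :
  gromov_product (rho g o) (rho g u) (rho g v) = gromov_product o u v.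
Proof. by rewrite /gromov_product !isom_act_isometry. Qed.

Lemma mdist_actV g o : mdist o (rho g^-1%g o) = mdist o (rho g o).
Proof. by rewrite -(isom_act_isometry rho g) isom_actVK metric_sym. Qed.

Lemma gromov_product_orbit g o u :
  gromov_product o (rho g u) (rho g o) =
  mdist o (rho g o) - gromov_product o u (rho g^-1%g o).
Proof.
rewrite /gromov_product isom_act_isometry.
have -> : mdist u (rho g^-1%g o) = mdist (rho g u) o.
  by rewrite -(isom_act_isometry rho g) isom_actVK.
by rewrite !(metric_sym _ o) mdist_actV (metric_sym o (rho g u)); lra.
Qed.

Lemma converges_to_act g x a :
  converges_to x a -> converges_to (rho g \o x) (boundary_act rho g a).
Proof. by move=> xa; exists x. Qed.

Lemma converges_to_actE g y a : converges_to y (boundary_act rho g a) ->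
  exists2 x, converges_to x a & y = rho g \o x.
Proof. by move=> [x xa <-]; exists x. Qed.

(* If [g] fixes [a] then [<g o|a> + <g^-1 o|a>] is [d(o, g o)], up to a bounded
   error. *)
Lemma fixed_product o : exists2 K : R, 0 <= K &
  forall g x a C, converges_to x a -> boundary_act rho g a = a ->
  (exists N, forall i, (N <= i)%N -> gromov_product o (rho g o) (x i) <= C) ->
  eventually_ge o (rho g^-1%g o) x (mdist o (rho g o) - C - K).
Proof.
have [d d0 hyp] := @gromov_product_hyp R S; exists d => // g x a C xa ga.
move=> [N HN].
have gxa : converges_to (rho g \o x) a.
  by rewrite -[a]ga; exact: converges_to_act.
have [N1 HN1] := sim_ge o (C + d + 1) (converges_to_sim gxa xa).
exists (maxn N N1) => i; rewrite geq_max => /andP[iN iN1].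
rewrite gromov_productC.
have -> : gromov_product o (x i) (rho g^-1%g o) =
    mdist o (rho g o) - gromov_product o (rho g (x i)) (rho g o).
  by rewrite gromov_product_orbit; lra.
suff : gromov_product o (rho g (x i)) (rho g o) <= C + d by lra.
rewrite leNgt; apply/negP => h.
(* A common lower bound for both links of the chain [rho g o], [rho g (x i)], [x i]; it exceeds
   [C + d], so hyperbolicity contradicts the bound [C]. *)
pose m := Num.min (C + d + 1) (gromov_product o (rho g (x i)) (rho g o)).
have Cm : C + d < m by rewrite lt_min h andbT; lra.
have := HN i iN.
have h1 : m <= gromov_product o (rho g o) (rho g (x i)).
  by rewrite gromov_productC ge_min lexx orbT.
have h2 : m <= gromov_product o (rho g (x i)) (x i).
  by apply: le_trans (HN1 i i iN1 iN1); rewrite ge_min lexx.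
have := hyp _ _ _ _ _ h1 h2; lra.
Qed.

(** No point is close to both ends. If [g o] is not close to one of them, [fixed_product] puts
    [g^-1 o] close to it, hence not close to the other; applied to [g^-1], it then puts [g o] close
    to the other. *)
Lemma two_fixed_points o x y a b : converges_to x a -> converges_to y b ->
  a <> b -> exists2 K : R, 0 <= K & forall g,
    boundary_act rho g a = a -> boundary_act rho g b = b ->
    boundary_act rho g^-1%g a = a -> boundary_act rho g^-1%g b = b ->
    eventually_ge o (rho g o) x (mdist o (rho g o) - K) \/
    eventually_ge o (rho g o) y (mdist o (rho g o) - K).
Proof.
move=> xa yb ab; have [d d0 hyp] := @gromov_product_hyp R S.
have [K K0 fixK] := fixed_product o.
have [L L0 [N HN]] := distinct_product_bounded o xa yb ab.
pose C := L + d + 1.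
have excl u :
    (exists N', forall i, (N' <= i)%N -> gromov_product o u (x i) <= C) \/
    (exists N', forall i, (N' <= i)%N -> gromov_product o u (y i) <= C).
  have [[i [iN hi]]|h] :=
      pselect (exists i, (N <= i)%N /\ C < gromov_product o u (x i)).
    right; exists N => j jN; rewrite leNgt; apply/negP => hj.
    have h1 : C <= gromov_product o (x i) u by rewrite gromov_productC ltW.
    have := hyp _ _ _ _ _ h1 (ltW hj); have := HN i j iN jN; rewrite /C; lra.
  left; exists N => i iN; rewrite leNgt; apply/negP => hi.
  by apply: h; exists i.
have flip u x' y' (r : R) : C < r -> eventually_ge o u x' r ->
    ((exists N', forall i, (N' <= i)%N -> gromov_product o u (x' i) <= C) \/
     (exists N', forall i, (N' <= i)%N -> gromov_product o u (y' i) <= C)) ->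
    exists N', forall i, (N' <= i)%N -> gromov_product o u (y' i) <= C.
  move=> Cr [N1 H1] [[N2 H2]|//].
  have := H1 _ (leq_maxl N1 N2); have := H2 _ (leq_maxr N1 N2); lra.
have C0 : 0 <= C by rewrite /C; lra.
exists (2 * C + K + 1) => [|g ga gb gVa gVb]; first lra.
(* Up to this displacement the claimed lower bound is nonpositive; beyond it,
   [mdist o (rho g o) - C - K] exceeds [C], as [flip] requires. *)
have [dg|dg] := leP (mdist o (rho g o)) (2 * C + K + 1).
  left; exists 0%N => i _; have := gromov_product_ge0 o (rho g o) (x i); lra.
have [Hx|Hy] := excl (rho g o).
  right.
  have Vx := fixK _ _ _ _ xa ga Hx.
  have [|N' HN'] := flip _ _ y _ _ Vx (excl _); first lra.
  have := fixK _ _ _ C yb gVb (ex_intro _ N' HN').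
  rewrite invgK mdist_actV => -[N2 H2]; exists N2 => i /H2; lra.
left.
have Vy := fixK _ _ _ _ yb gb Hy.
have [||N' HN'] := flip _ _ x _ _ Vy.
- lra.
- by have [?|?] := excl (rho g^-1%g o); [right|left].
have := fixK _ _ _ C xa gVa (ex_intro _ N' HN').
by rewrite invgK mdist_actV => -[N2 H2]; exists N2 => i /H2; lra.
Qed.

Lemma cyclic_subgroupV g p : cyclic_subgroup g p -> cyclic_subgroup g p^-1%g.
Proof.
by move=> [n [->|->]]; exists n; rewrite ?invgK; [right|left].
Qed.

Lemma loxodromic_ends o g : loxodromic rho g -> exists x y a b (K : R),
  [/\ converges_to x a, converges_to y b,
    fixed_points (boundary_act rho) [set g] a,
    fixed_points (boundary_act rho) [set g] b &
    forall p, cyclic_subgroup g p ->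
      eventually_ge o (rho p o) x (mdist o (rho p o) - K) \/
      eventually_ge o (rho p o) y (mdist o (rho p o) - K)].
Proof.
move=> [_ [a [b [ab fab]]]].
have fa p : cyclic_subgroup g p -> boundary_act rho p a = a.
  by have : [set a; b] a by [left]; rewrite -fab; apply.
have fb p : cyclic_subgroup g p -> boundary_act rho p b = b.
  by have : [set a; b] b by [right]; rewrite -fab; apply.
have gg : cyclic_subgroup g g by exists 1%N; left; rewrite expg1.
have [x xa] := converges_to_ex a; have [y yb] := converges_to_ex b.
have [K _ HK] := two_fixed_points o xa yb ab.
exists x, y, a, b, K; split=> //; [by move=> _ ->; exact: fa|
  by move=> _ ->; exact: fb|].
move=> p gp; have gV := cyclic_subgroupV gp.
by apply: HK; [exact: fa|exact: fb|exact: fa|exact: fb].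
Qed.

Lemma unbounded_orbits_far o (H : set G) (T : R) : unbounded_orbits rho H ->
  exists2 p, H p & T <= mdist o (rho p o).
Proof.
move=> unb; apply: contrapT => h; apply: (unb o).
have far p : H p -> mdist o (rho p o) <= T.
  by move=> Hp; rewrite leNgt; apply/negP => /ltW ?; apply: h; exists p.
exists (T + T) => _ _ [p /far pT <-] [q /far qT <-].
have := metric_triangle (rho p o) o (rho q o).
by rewrite (metric_sym (rho p o) o); lra.
Qed.

(** Otherwise the chain [x i], [rho p o], [rho q o], [y i] would push the product of [x i] and [y i]
    above [L]. *)
Lemma distinct_ends_bounded o x y a b (K : R) : converges_to x a ->
  converges_to y b -> a <> b -> exists B : R, forall p q : G,
    B <= mdist o (rho p o) -> B <= mdist o (rho q o) ->
    eventually_ge o (rho p o) x (mdist o (rho p o) - K) ->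
    eventually_ge o (rho q o) y (mdist o (rho q o) - K) ->
    gromov_product o (rho p o) (rho q o) <= B.
Proof.
move=> xa yb ab; have [d d0 hyp] := @gromov_product_hyp R S.
have [L L0 [N HN]] := distinct_product_bounded o xa yb ab.
pose M := L + d + d + 1; exists (M + `|K|) => p q dp dq [N1 H1] [N2 H2].
have := ler_norm K; have := normr_ge0 K => K0 K1.
rewrite leNgt; apply/negP => h.
pose i := maxn N (maxn N1 N2).
have iN : (N <= i)%N by rewrite leq_maxl.
have iN1 : (N1 <= i)%N by rewrite leq_max leq_maxl orbT.
have iN2 : (N2 <= i)%N by rewrite !leq_max leqnn !orbT.
have h1 : M <= gromov_product o (x i) (rho p o).
  by rewrite gromov_productC; have := H1 i iN1; lra.
have h2 : M <= gromov_product o (rho p o) (rho q o) by lra.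
have h3 := hyp _ _ _ _ _ h1 h2.
have h4 : M - d <= gromov_product o (rho q o) (y i) by have := H2 i iN2; lra.
have := hyp _ _ _ _ _ h3 h4; have := HN i i iN iN; rewrite /M; lra.
Qed.

Lemma eventually_ge_le o u x (r r' : R) :
  r' <= r -> eventually_ge o u x r -> eventually_ge o u x r'.
Proof. by move=> rr' [N HN]; exists N => i /HN; exact: le_trans. Qed.

(** [p] and [q] are far-moving powers of two loxodromic elements without common fixed points. Their
    orbit points and those of their inverses lie near the ends, and the four pairs of ends give a
    [B] independent of [T]. *)
Lemma general_type_transverse o : general_type rho -> exists B : R,
  forall T : R, exists p q : G,
  [/\ T <= mdist o (rho p o), T <= mdist o (rho q o) &
  forall p' q', p' = p \/ p' = p^-1%g -> q' = q \/ q' = q^-1%g ->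
    gromov_product o (rho p' o) (rho q' o) <= B].
Proof.
move=> [_ [g [h [lg lh gh]]]].
have [x [y [a [b [K [xa yb ga gb HK]]]]]] := loxodromic_ends o lg.
have [x' [y' [a' [b' [K' [xa' yb' ha hb HK']]]]]] := loxodromic_ends o lh.
have neq c c' : fixed_points (boundary_act rho) [set g] c ->
    fixed_points (boundary_act rho) [set h] c' -> c <> c'.
  move=> gc hc cc'; have : set0 c by rewrite -gh; split=> //; rewrite cc'.
  by [].
pose L := Num.max K K'.
have KL : K <= L by rewrite le_max lexx.
have KL' : K' <= L by rewrite le_max lexx orbT.
have [B1 H1] := distinct_ends_bounded o L xa xa' (neq _ _ ga ha).
have [B2 H2] := distinct_ends_bounded o L xa yb' (neq _ _ ga hb).
have [B3 H3] := distinct_ends_bounded o L yb xa' (neq _ _ gb ha).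
have [B4 H4] := distinct_ends_bounded o L yb yb' (neq _ _ gb hb).
pose B := Num.max (Num.max B1 B2) (Num.max B3 B4).
have [BB1 BB2 BB3 BB4] : [/\ B1 <= B, B2 <= B, B3 <= B & B4 <= B].
  by rewrite /B !le_max !lexx !orbT.
exists B => T; pose T' := Num.max T B.
have TT' : T <= T' by rewrite le_max lexx.
have BT' : B <= T' by rewrite le_max lexx orbT.
have [p gp dp] := unbounded_orbits_far o T' lg.1.
have [q hq dq] := unbounded_orbits_far o T' lh.1.
exists p, q; split; [exact: le_trans dp|exact: le_trans dq|] => p' q' pp' qq'.
have {gp pp'}[gp dp'] : cyclic_subgroup g p' /\ B <= mdist o (rho p' o).
  case: pp' => ->; first by split=> //; exact: le_trans dp.
  by split; [exact: cyclic_subgroupV|rewrite mdist_actV; exact: le_trans dp].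
have {hq qq'}[hq dq'] : cyclic_subgroup h q' /\ B <= mdist o (rho q' o).
  case: qq' => ->; first by split=> //; exact: le_trans dq.
  by split; [exact: cyclic_subgroupV|rewrite mdist_actV; exact: le_trans dq].
have lep : mdist o (rho p' o) - L <= mdist o (rho p' o) - K by rewrite lerB.
have leq' : mdist o (rho q' o) - L <= mdist o (rho q' o) - K' by rewrite lerB.
case: (HK _ gp) => /(eventually_ge_le lep) Ep;
  case: (HK' _ hq) => /(eventually_ge_le leq') Eq.
- exact: le_trans (H1 _ _ (le_trans BB1 dp') (le_trans BB1 dq') Ep Eq) BB1.
- exact: le_trans (H2 _ _ (le_trans BB2 dp') (le_trans BB2 dq') Ep Eq) BB2.
- exact: le_trans (H3 _ _ (le_trans BB3 dp') (le_trans BB3 dq') Ep Eq) BB3.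
- exact: le_trans (H4 _ _ (le_trans BB4 dp') (le_trans BB4 dq') Ep Eq) BB4.
Qed.

(* If [u] is not close to [p^-1 o] then [p u], hence also [u], is close to
   [p o]. *)
Lemma moved_little o : exists2 d : R, 0 <= d & forall p u (C : R),
  C <= gromov_product o u (rho p u) -> C * 2 <= mdist o (rho p o) ->
  exists2 p', p' = p \/ p' = p^-1%g & C - d <= gromov_product o u (rho p' o).
Proof.
have [d d0 hyp] := @gromov_product_hyp R S; exists d => // p u C Cu Cp.
have [h|h] := leP C (gromov_product o u (rho p^-1%g o)).
  by exists p^-1%g; [right|lra].
exists p; [by left|apply: hyp Cu _].
by rewrite gromov_product_orbit; lra.
Qed.

(** One of [1], [p], [q] serves as [k]. Otherwise [v] is close to [u], [p u] and [q u], so by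
    [moved_little] [u] is close to both [p' o] and [q' o], against transversality. *)
Lemma general_type_spread o : general_type rho -> exists C D : R,
  forall u v, exists2 k : G, mdist o (rho k o) <= D &
    gromov_product o (rho k u) v <= C.
Proof.
move=> gt; have [d d0 hyp] := @gromov_product_hyp R S.
have [e e0 little] := moved_little o.
have [B HB] := general_type_transverse o gt.
pose M := B + e + d + 1.
have [p [q [dp dq pq]]] := HB (M * 2).
exists (M + d), (Num.max (mdist o (rho p o)) (mdist o (rho q o))) => u v.
apply: contrapT => h.
have far k : mdist o (rho k o) <=
    Num.max (mdist o (rho p o)) (mdist o (rho q o)) ->
    M + d <= gromov_product o (rho k u) v.
  move=> kD; rewrite leNgt; apply/negP => /ltW hk; apply: h.
  by exists k.
have h1 : M + d <= gromov_product o u v.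
  rewrite -{1}(isom_act1 rho u); apply: far.
  by rewrite isom_act1 mdistxx le_max mdist_ge0.
have near k : mdist o (rho k o) <=
    Num.max (mdist o (rho p o)) (mdist o (rho q o)) ->
    M <= gromov_product o u (rho k u).
  move=> /far hk; rewrite gromov_productC in hk.
  have := hyp _ _ _ _ _ h1 hk; lra.
have [|p' pp' hp] := little p u M _ dp.
  by apply: near; rewrite le_max lexx.
have [|q' qq' hq] := little q u M _ dq.
  by apply: near; rewrite le_max lexx orbT.
rewrite gromov_productC in hp.
have := hyp _ _ _ _ _ hp hq; have := pq _ _ pp' qq'; rewrite /M; lra.
Qed.

(** * Extreme proximality on the limit set *)

Lemma limit_set_orbit o a : limit_set rho a ->
  exists u : nat -> G, converges_to (fun i => rho (u i) o) a.
Proof.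
move=> [s [x [xs xa]]].
have /choice[u Hu] : forall i, exists g, rho g s = x i.
  by move=> i; have [g _ gs] := xs i; exists g.
exists u; have xx := converges_to_seq xa.
have sim : gromov_sim x (fun i => rho (u i) o).
  apply: (@gromov_sim_base _ _ o); apply/gromov_pinftyP => M.
  have [N HN] := sim_ge o (M + mdist s o) xx; exists N => i j iN jN.
  have := HN i j iN jN; rewrite /gromov_product -(Hu j).
  have := metric_triangle (rho (u j) s) (rho (u j) o) o.
  have := metric_triangle (x i) (rho (u j) s) (rho (u j) o).
  rewrite !isom_act_isometry; lra.
move: xa; rewrite /converges_to; case: (boundary_classP a) => y _ -> [_ yx].
split; last exact: gromov_sim_trans sim.
exact: gromov_sim_trans (gromov_sim_sym sim) sim.
Qed.

(* [g := u k v^-1] sends [o] close to [u o] and has inverse sending [o] close to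
   [v o], as soon as [k v^-1 o] and [u^-1 o] are not close to each other. *)
Lemma proximal_element o a b (M : R) : general_type rho ->
  limit_set rho a -> limit_set rho b -> exists g,
  exists x y, [/\ converges_to x a, converges_to y b,
    eventually_ge o (rho g^-1%g o) x M & eventually_ge o (rho g o) y M].
Proof.
move=> gt /(limit_set_orbit o)[v va] /(limit_set_orbit o)[u ub].
have [d d0 hyp] := @gromov_product_hyp R S.
have [C [D HCD]] := general_type_spread o gt.
(* [C] bounds the product of [k v^-1 o] and [u^-1 o], [D] pays for the change of base point needed
   for [g^-1], and [d] for passing from index [i] to [j]. *)
pose T := `|M| + d + `|C| + `|D|.
have [N1 H1] := sim_ge o T (converges_to_seq va).
have [N2 H2] := sim_ge o T (converges_to_seq ub).
pose i := maxn N1 N2.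
have iN1 : (N1 <= i)%N by exact: leq_maxl.
have iN2 : (N2 <= i)%N by exact: leq_maxr.
have [k kD kC] := HCD (rho (v i)^-1%g o) (rho (u i)^-1%g o).
have [M1 M0] := (ler_norm M, normr_ge0 M).
have [C1 C0] := (ler_norm C, normr_ge0 C).
have [D1 D0] := (ler_norm D, normr_ge0 D).
have M2 : M <= T - `|C| - `|D| - d by rewrite /T; lra.
exists (u i * (k * (v i)^-1))%g, (fun j => rho (v j) o), (fun j => rho (u j) o).
split=> //.
- exists N1 => j jN; apply: (le_trans M2).
  apply: (hyp _ _ _ (rho (v i) o)); last first.
    by apply: le_trans (H1 i j iN1 jN); lra.
  rewrite !invgM invgK -mulgA !isom_actM gromov_product_orbit.
  have := H1 i i iN1 iN1; rewrite gromov_product_diag.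
  suff : gromov_product o (rho k^-1%g (rho (u i)^-1%g o)) (rho (v i)^-1%g o) <=
    C + D by lra.
  apply: (le_trans (gromov_product_base _ (rho k^-1%g o) _ _)).
  rewrite mdist_actV; apply: lerD kD.
  have -> : rho (v i)^-1%g o = rho k^-1%g (rho k (rho (v i)^-1%g o)).
    by rewrite isom_actK.
  by rewrite gromov_product_act gromov_productC.
- exists N2 => j jN; apply: (le_trans M2).
  apply: (hyp _ _ _ (rho (u i) o)); last first.
    by apply: le_trans (H2 i j iN2 jN); lra.
  rewrite !isom_actM gromov_product_orbit.
  have := H2 i i iN2 iN2; rewrite gromov_product_diag; lra.
Qed.

Lemma boundary_proximal a b (A B : set (boundary S)) : general_type rho ->
  limit_set rho a -> limit_set rho b -> nbhs a A -> nbhs b B ->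
  exists g, forall c, ~ A c -> B (boundary_act rho g c).
Proof.
move=> gt la lb nA nB; have [x0 _] := converges_to_ex a; pose o := x0 0%N.
have [d d0 hyp] := @gromov_product_hyp R S.
have [r r0 rA] := (boundary_nbhs_base o _ _).1 nA.
have [t t0 tB] := (boundary_nbhs_base o _ _).1 nB.
(* The displacement of [g], at least [M], minus the bound in [far] leaves [t + 1 + d + d]. The
   multiples of [d] cover the links of the two chains below, and each [1] makes an inequality
   strict. *)
pose M := r + 1 + d + d + d + (t + 1 + d + d).
have M1 : r + 1 + d + d + d <= M by rewrite /M; lra.
have M2 : t + 1 + d + d <= M by rewrite /M; lra.
have [g [x [y [xa yb gx gy]]]] := proximal_element o M gt la lb.
exists g => c nAc; apply: tB.
have dg : M <= mdist o (rho g o).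
  have [N HN] := gy; apply: le_trans (HN N (leqnn _)) _.
  exact: gromov_product_le.
(* One late [z l] close to [g^-1 o] would already put [c] in [A], by the chain [x' i], [x n],
   [g^-1 o], [z l], [z' j]. *)
have far z : converges_to z c -> exists N, forall i, (N <= i)%N ->
    gromov_product o (z i) (rho g^-1%g o) <= r + 1 + d + d + d.
  move=> zc; apply: contrapT => hz; apply/nAc/rA.
  apply: (@lt_le_trans _ _ (r + 1)%:E%E); first by rewrite lte_fin; lra.
  apply: boundary_product_ge => x' z' xa' zc'.
  have [N1 H1] := gx.
  have [N2 H2] := sim_ge o M (converges_to_sim xa' xa).
  have [N3 H3] := sim_ge o M (converges_to_sim zc zc').
  have [l lN hl] : exists2 l, (N3 <= l)%N &
      r + 1 + d + d + d <= gromov_product o (z l) (rho g^-1%g o).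
    apply: contrapT => hl; apply: hz; exists N3 => i iN.
    by rewrite leNgt; apply/negP => /ltW ?; apply: hl; exists i.
  exists (maxn N2 N3) => i j; rewrite !geq_max => /andP[i2 _] /andP[_ j3].
  pose n := maxn N1 N2.
  have h1 : r + 1 + d + d + d <= gromov_product o (x' i) (x n).
    by apply: (le_trans M1); apply: H2 => //; exact: leq_maxr.
  have h2 : r + 1 + d + d + d <= gromov_product o (x n) (rho g^-1%g o).
    rewrite gromov_productC; apply: (le_trans M1); apply: H1; exact: leq_maxl.
  have h3 := hyp _ _ _ _ _ h1 h2.
  have h4 : r + 1 + d + d + d - d <= gromov_product o (rho g^-1%g o) (z l).
    by rewrite gromov_productC; lra.
  have h5 := hyp _ _ _ _ _ h3 h4.
  have h6 : r + 1 + d + d + d - d - d <= gromov_product o (z l) (z' j).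
    by apply: le_trans (H3 l j lN j3); lra.
  by have := hyp _ _ _ _ _ h5 h6; lra.
apply: (@lt_le_trans _ _ (t + 1)%:E%E); first by rewrite lte_fin; lra.
apply: boundary_product_ge => y' w yb' /converges_to_actE[z zc ->].
have [N1 H1] := gy.
have [N2 H2] := sim_ge o M (converges_to_sim yb' yb).
have [N3 H3] := far z zc.
exists (maxn N2 N3) => i j; rewrite !geq_max => /andP[i2 _] /andP[_ j3].
pose n := maxn N1 N2.
have h1 : t + 1 + d + d <= gromov_product o (y' i) (y n).
  by apply: (le_trans M2); apply: H2 => //; exact: leq_maxr.
have h2 : t + 1 + d + d <= gromov_product o (y n) (rho g o).
  rewrite gromov_productC; apply: (le_trans M2); apply: H1; exact: leq_maxl.
have h3 := hyp _ _ _ _ _ h1 h2.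
have h4 : t + 1 + d + d - d <= gromov_product o (rho g o) (rho g (z j)).
  rewrite gromov_productC gromov_product_orbit.
  by have := H3 j j3; move: dg; rewrite /M; lra.
by have := hyp _ _ _ _ _ h3 h4; rewrite /=; lra.
Qed.

(** * The induced actions by homeomorphisms *)

Lemma boundary_act_continuous g : continuous (boundary_act rho g).
Proof.
move=> a A nA; have [x0 _] := converges_to_ex a; pose o := x0 0%N.
(* With base point [rho g o] in the target, [g] preserves Gromov products exactly. *)
have [r r0 rA] := (boundary_nbhs_base (rho g o) _ _).1 nA.
apply/(boundary_nbhs_base o); exists (r + 1) => [|b /= ab]; first lra.
apply: rA; apply: (@lt_le_trans _ _ (r + 1)%:E%E).
  by rewrite lte_fin; lra.
apply: boundary_product_ge => x' y' /converges_to_actE[x xa x'E].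
move=> /converges_to_actE[y yb y'E].
have [N HN] := boundary_productP ab xa yb; exists N => i j iN jN.
by rewrite x'E y'E gromov_product_act; exact: HN.
Qed.

Lemma boundary_act1 a : boundary_act rho 1%g a = a.
Proof.
have [x xa] := converges_to_ex a.
apply: (@converges_to_sim_eq _ _ (rho 1%g \o x) x) => //.
  exact: converges_to_act.
have -> : rho 1%g \o x = x by apply/funext => i /=; rewrite isom_act1.
exact: converges_to_seq xa.
Qed.

Lemma boundary_actM g h a :
  boundary_act rho (g * h)%g a = boundary_act rho g (boundary_act rho h a).
Proof.
have [x xa] := converges_to_ex a.
apply: (@converges_to_sim_eq _ _ (rho (g * h)%g \o x) (rho g \o (rho h \o x))).
- exact: converges_to_act.
- exact/converges_to_act/converges_to_act.
- have -> : rho g \o (rho h \o x) = rho (g * h)%g \o x.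
    by apply/funext => i /=; rewrite isom_actM.
  exact: gromov_sim_act (converges_to_seq xa).
Qed.

Lemma limit_act1 (c : limit_set rho) : limit_act rho 1%g c = c.
Proof. by apply: val_inj; exact: boundary_act1. Qed.

Lemma limit_actM g h (c : limit_set rho) :
  limit_act rho (g * h)%g c = limit_act rho g (limit_act rho h c).
Proof. by apply: val_inj; exact: boundary_actM. Qed.

Lemma limit_act_continuous g : continuous (limit_act rho g).
Proof.
apply/continuousP => _ [A oA <-].
exists (boundary_act rho g @^-1` A) => //.
by apply: open_comp => // c _; exact: boundary_act_continuous.
Qed.

Lemma limit_act_proximal : general_type rho ->
  extremely_proximal (limit_act rho) setT.
Proof.
move=> gt U V [A oA AU] [B oB BV] [a Ua] [b Vb].
have [Aa Bb] : A (\val a) /\ B (\val b) by move: Ua Vb; rewrite -AU -BV.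
have [g gAB] := boundary_proximal gt (set_mem (valP a)) (set_mem (valP b))
  (open_nbhs_nbhs (conj oA Aa)) (open_nbhs_nbhs (conj oB Bb)).
exists g => // c; rewrite -AU -BV; exact: gAB.
Qed.

End Isometries.

(** * Hausdorff property and conclusion *)

Lemma boundary_hausdorff (R : realType) (S : hyperbolicType R) :
  hausdorff_space (boundary S).
Proof.
move=> a b ab.
have [x xa] := converges_to_ex a; have [y yb] := converges_to_ex b.
have [d d0 hyp] := @gromov_product_hyp R S; pose o := x 0%N.
apply: (converges_to_sim_eq xa yb).
apply: (@gromov_sim_base _ _ o); apply/gromov_pinftyP => M.
pose r := (`|M| + d)%R.
have r0 : (0 <= r)%R by rewrite addr_ge0.
have nr c : nbhs c [set c' | (r%:E < boundary_product o c c')%E].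
  by apply/(boundary_nbhs_base o); exists r.
(* A point [c] common to both neighborhoods links [x] to [y] at the cost of one [d]. *)
have [c [ac bc]] := ab _ _ (nr a) (nr b).
have [z zc] := converges_to_ex c.
have [N1 H1] := boundary_productP ac xa zc.
have [N2 H2] := boundary_productP bc yb zc.
exists (maxn N1 N2) => i j; rewrite !geq_max => /andP[i1 _] /andP[_ j2].
have h1 := H1 i _ i1 (leq_maxl N1 N2).
have h2 := H2 j _ j2 (leq_maxr N1 N2); rewrite gromov_productC in h2.
have := hyp _ _ _ _ _ h1 h2; rewrite /r addrK; apply: le_trans.
exact: ler_norm.
Qed.

Lemma set_type_hausdorff (X : topologicalType) (A : set X) :
  hausdorff_space X -> hausdorff_space A.
Proof.
move=> hX p q pq; apply: val_inj; apply: hX => U V nU nV.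
have [t [Ut Vt]] := pq _ _ (@initial_continuous _ _ (set_val : A -> X) p _ nU)
  (@initial_continuous _ _ (set_val : A -> X) q _ nV).
by exists (set_val t).
Qed.

Theorem proposition1p4 (R : realType) (G : groupType) :
  faithful_weakly_hyperbolic R G -> ~ lim_free R G ->
  monolithic G /\ infinite_set (monolith G) /\ simple_subgroup (monolith G).
Proof.
move=> [S [rho [gt faithful]]] nfree.
apply: (@proximal_monolith _ _ (limit_act rho)) => //.
- exact: limit_act1.
- exact: limit_actM.
- exact: limit_act_continuous.
- exact/set_type_hausdorff/boundary_hausdorff.
- exact: limit_act_proximal.
- by move=> free; apply: nfree; exists S, rho.
Qed.
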